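(* The following is a complete list, up to isomorphism, of left braces $G$ of order $8$ (that is: each item below defines a left brace, with additive group, order of the socle and isomorphism type of the multiplicative group $(G,\cdot)$ as indicated, and every left brace of order $8$ is isomorphic to exactly one of them). **1. Additive group $\mathbb{Z}/(8)$.** Socle of order $2$: - $x_1\cdot x_2=x_1+x_2+2x_1x_2$; $(G,\cdot)\cong\mathbb{Z}/(2)\times\mathbb{Z}/(4)$. Socle of order $4$: - $x_1\cdot x_2=x_1+(1+2\alpha)^{x_1}x_2$, for $\alpha=1,2,3$; $(G,\cdot)\cong Q$ if $\alpha=1$, $\cong\mathbb{Z}/(8)$ if $\alpha=2$, $\cong D_4$ if $\alpha=3$. Socle of order $8$: - $x_1\cdot x_2=x_1+x_2$; $(G,\cdot)\cong\mathbb{Z}/(8)$. **2. Additive group $\mathbb{Z}/(2)\times\mathbb{Z}/(4)$.** Socle of order $1$ (elements written as $(y,\,z+2x)$ with $x,y,z\in\{0,1\}$): - $(y_1,z_1+2x_1)\cdot(y_2,z_2+2x_2)=\big(y_1+y_2+(x_1+y_1+z_1+y_1z_1)z_2,\; z_1+2x_1+2z_1y_2+2(y_1+x_1z_1)z_2+z_2+2x_2\big)$; $(G,\cdot)\cong D_4$. Socle of order $2$, with $(x_1,y_1)\cdot(x_2,y_2)$ equal to: - $(x_1+x_2,\;y_1+y_2+2x_1x_2+2y_1y_2)$; $(G,\cdot)\cong\mathbb{Z}/(2)\times\mathbb{Z}/(4)$. - $(x_1+x_2,\;y_1+y_2+2(x_1+y_1)x_2+2y_1y_2)$; $(G,\cdot)\cong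 D_4$. - $(x_1+x_2,\;y_1+y_2+2y_1x_2+2x_1y_2)$; $(G,\cdot)\cong\mathbb{Z}/(2)\times\mathbb{Z}/(4)$. - $(x_1+x_2,\;y_1+y_2+2y_1x_2+2(x_1+y_1)y_2)$; $(G,\cdot)\cong(\mathbb{Z}/(2))^3$. - $(x_1+x_2+y_1y_2,\;y_1+y_2+2y_1x_2+2x_1y_2)$; $(G,\cdot)\cong\mathbb{Z}/(2)\times\mathbb{Z}/(4)$. - $\big(x_1+x_2+y_2\sum_{i=1}^{y_1-1}i,\;y_1+y_2+2y_1y_2\big)$; $(G,\cdot)\cong D_4$. Socle of order $4$, with $(x_1,y_1)\cdot(x_2,y_2)$ equal to: - $(x_1+x_2,\;y_1+y_2+2x_1y_2)$; $(G,\cdot)\cong D_4$. - $(x_1+x_2,\;y_1+y_2+2y_1y_2)$; $(G,\cdot)\cong(\mathbb{Z}/(2))^3$. - $(x_1+x_2,\;y_1+y_2+2y_1x_2)$; $(G,\cdot)\cong D_4$. - $(x_1+x_2,\;y_1+y_2+2x_1x_2)$; $(G,\cdot)\cong\mathbb{Z}/(2)\times\mathbb{Z}/(4)$. - $(x_1+x_2,\;y_1+y_2+2(x_1+y_1)x_2)$; $(G,\cdot)\cong Q$. - $(x_1+x_2+y_1y_2,\;y_1+y_2)$; $(G,\cdot)\cong\mathbb{Z}/(2)\times\mathbb{Z}/(4)$. Socle of order $8$: - $(x_1,y_1)\cdot(x_2,y_2)=(x_1+x_2,\;y_1+y_2)$; $(G,\cdot)\cong\mathbb{Z}/(2)\times\mathbb{Z}/(4)$.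 **3. Additive group $(\mathbb{Z}/(2))^3$**, with $(x_1,y_1,z_1)\cdot(x_2,y_2,z_2)$ equal to: Socle of order $1$: - $(x_1+x_2+z_1y_2+x_1z_2+y_1z_2+x_1z_1z_2,\;y_1+y_2+z_1z_2+x_1z_2+y_1z_1z_2,\;z_1+z_2)$; $(G,\cdot)\cong D_4$. Socle of order $2$: - $(x_1+x_2+z_1y_2+y_1z_2,\;y_1+y_2,\;z_1+z_2)$; $(G,\cdot)\cong(\mathbb{Z}/(2))^3$. - $(x_1+x_2+y_1y_2+z_1z_2,\;y_1+y_2,\;z_1+z_2)$; $(G,\cdot)\cong\mathbb{Z}/(2)\times\mathbb{Z}/(4)$. - $(x_1+x_2+(y_1+z_1)y_2+z_1z_2,\;y_1+y_2,\;z_1+z_2)$; $(G,\cdot)\cong Q$. - $(x_1+x_2+z_1y_2+y_1z_2,\;y_1+y_2+z_1z_2,\;z_1+z_2)$; $(G,\cdot)\cong\mathbb{Z}/(2)\times\mathbb{Z}/(4)$. Socle of order $4$: - $(x_1+x_2+y_1y_2,\;y_1+y_2,\;z_1+z_2)$; $(G,\cdot)\cong\mathbb{Z}/(2)\times\mathbb{Z}/(4)$. - $(x_1+x_2+z_1y_2,\;y_1+y_2,\;z_1+z_2)$; $(G,\cdot)\cong D_4$. Socle of order $8$: - $(x_1+x_2,\;y_1+y_2,\;z_1+z_2)$; $(G,\cdot)\cong(\mathbb{Z}/(2))^3$.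
   Context: A left brace is a set $B$ with two operations $+$ and $\cdot$ such that $(B,+)$ is an abelian group, $(B,\cdot)$ is a group, and $a\cdot(b+c)+a=a\cdot b+a\cdot c$ for all $a,b,c\in B$. A morphism of left braces is a map preserving both operations. For $a\in B$, $\lambda_a(b)=a\cdot b-a$; this is an automorphism of $(B,+)$. The socle of $B$ is $\mathrm{Soc}(B)=\{a\in B:\lambda_a=\mathrm{id}\}$. Notation: a dot denotes the brace multiplication; juxtaposition denotes ordinary ring multiplication. The additive structure of each brace is the usual componentwise addition of the indicated group. In $\mathbb{Z}/(2)\times\mathbb{Z}/(4)$, elements are written $(x,y)$ with $x\in\mathbb{Z}/(2)$, $y\in\mathbb{Z}/(4)$; expressions in the first component are reduced mod $2$ and expressions in the second component mod $4$ (for $u\in\mathbb{Z}/(2)$, $2u$ is a well-defined element of $\mathbb{Z}/(4)$). In $\sum_{i=1}^{y_1-1}i$, $y_1$ is represented by an integer in $\{0,1,2,3\}$, the sum being $0$ when $y_1\in\{0,1\}$. $D_4=\langle x,y\mid x^2=y^4=1,\ yx=xy^3\rangle$ is the dihedral group of order $8$ and $Q=\langle x,y\mid x^2=y^2,\ x^4=y^4=1,\ y^{-1}xy=x^{-1}\rangle$ is the quaternion group of order $8$. *)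

(* Defs.v *)
From HB Require Import structures.
From mathcomp Require Import all_boot all_order all_algebra all_fingroup.
From mathcomp Require Import all_solvable.
Set Implicit Arguments.
Unset Strict Implicit.
Unset Printing Implicit Defensive.
Import GRing.Theory.
Local Open Scope ring_scope.

Definition is_group (T : Type) (mul : T -> T -> T) : Prop :=
  associative mul /\
  exists e : T, [/\ left_id e mul, right_id e mul &
    forall x, exists y, mul y x = e /\ mul x y = e].

Definition left_brace (B : zmodType) (mul : B -> B -> B) : Prop :=
  is_group mul /\
  forall a b c : B, mul a (b + c) + a = mul a b + mul a c.

Definition brace_isom (B C : zmodType) (mulB : B -> B -> B)
    (mulC : C -> C -> C) : Prop :=
  exists f : B -> C, [/\ bijective f, {morph f : a b / a + b} &
    {morph f : a b / mulB a b >-> mulC a b}].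

Definition brace_lambda (B : zmodType) (mul : B -> B -> B) (a b : B) : B :=
  mul a b - a.

Definition socle (B : finZmodType) (mul : B -> B -> B) : {set B} :=
  [set a | [forall b, brace_lambda mul a b == b]].

Definition op_isom (S T : Type) (mulS : S -> S -> S)
    (mulT : T -> T -> T) : Prop :=
  exists2 f : S -> T, bijective f & {morph f : a b / mulS a b >-> mulT a b}.

HB.instance Definition _ (A B : finZmodType) := GRing.Zmodule.on (A * B)%type.

Notation Z2xZ4 := ('Z_2 * 'Z_4)%type.
Notation Z2xZ2xZ2 := ('Z_2 * 'Z_2 * 'Z_2)%type.

Inductive group8 := GZ8 | GZ2xZ4 | GZ2xZ2xZ2 | GD4 | GQ.

Definition has_group_type (T : Type) (mul : T -> T -> T) (t : group8) : Prop :=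
  match t with
  | GZ8 => op_isom mul (fun a b : 'Z_8 => a + b)
  | GZ2xZ4 => op_isom mul (fun a b : Z2xZ4 => a + b)
  | GZ2xZ2xZ2 => op_isom mul (fun a b : Z2xZ2xZ2 => a + b)
  | GD4 => exists2 gT : finGroupType,
      ([set: gT] \isog
        Grp (x : y : x ^+ 2 = y ^+ 4 = 1, y * x = x * y ^+ 3))%g &
      op_isom mul (fun a b : gT => (a * b)%g)
  | GQ => exists2 gT : finGroupType,
      ([set: gT] \isog
        Grp (x : y : x ^+ 2 = y ^+ 2, x ^+ 4 = y ^+ 4 = 1,
                     y^-1 * x * y = x^-1))%g &
      op_isom mul (fun a b : gT => (a * b)%g)
  end.

Inductive additive8 := AZ8 | AZ2xZ4 | AZ2xZ2xZ2.

Definition additive_group (k : additive8) : finZmodType :=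
  match k with AZ8 => 'Z_8 | AZ2xZ4 => Z2xZ4 | AZ2xZ2xZ2 => Z2xZ2xZ2 end.

(* Tagging by [additive8], instead of storing a [finZmodType], keeps this type
   in a universe small enough for [seq] and [tnth]. *)
Record brace_entry := BraceEntry {
  entry_tag : additive8;
  entry_soc : nat;
  entry_type : group8;
  entry_op : additive_group entry_tag -> additive_group entry_tag ->
    additive_group entry_tag }.

Definition entry_add (E : brace_entry) : finZmodType :=
  additive_group (entry_tag E).
Definition entry_mul (E : brace_entry) :
  entry_add E -> entry_add E -> entry_add E := @entry_op E.
Arguments entry_mul E _ _ : clear implicits.

Definition Z8_entry (s : nat) (t : group8) (mul : 'Z_8 -> 'Z_8 -> 'Z_8) :=
  @BraceEntry AZ8 s t mul.
Definition Z2xZ4_entry (s : nat) (t : group8)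
    (mul : Z2xZ4 -> Z2xZ4 -> Z2xZ4) := @BraceEntry AZ2xZ4 s t mul.
Definition Z2xZ2xZ2_entry (s : nat) (t : group8)
    (mul : Z2xZ2xZ2 -> Z2xZ2xZ2 -> Z2xZ2xZ2) := @BraceEntry AZ2xZ2xZ2 s t mul.

(* The exponent [x1] is the representative of [x1] in {0, ..., 7}. *)
Definition braces_Z8 : seq brace_entry :=
  [:: Z8_entry 2 GZ2xZ4 (fun x1 x2 => x1 + x2 + 2 * x1 * x2);
      Z8_entry 4 GQ  (fun x1 x2 => x1 + (1 + 2 * 1) ^+ x1 * x2);
      Z8_entry 4 GZ8 (fun x1 x2 => x1 + (1 + 2 * 2) ^+ x1 * x2);
      Z8_entry 4 GD4 (fun x1 x2 => x1 + (1 + 2 * 3) ^+ x1 * x2);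
      Z8_entry 8 GZ8 (fun x1 x2 => x1 + x2)].

(* Formulas over Z/(2) x Z/(4) mix both moduli: they are evaluated in nat on
   the canonical representatives (the coordinates coerce to nat), and the
   results are reduced mod 2 and mod 4. *)
Definition red24 (m n : nat) : Z2xZ4 := (m%:R, n%:R).
Arguments red24 (m n)%_nat_scope.

Definition braces_Z2xZ4 : seq brace_entry :=
  [:: (* the second coordinate is w = z + 2x with x, z in {0, 1} *)
      Z2xZ4_entry 1 GD4 (fun '(y1, w1) '(y2, w2) =>
        let z1 := (w1 %% 2)%N in let x1 := (w1 %/ 2)%N in
        let z2 := (w2 %% 2)%N in let x2 := (w2 %/ 2)%N in
        red24 (y1 + y2 + (x1 + y1 + z1 + y1 * z1) * z2)
              (z1 + 2 * x1 + 2 * z1 * y2 + 2 * (y1 + x1 * z1) * z2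
               + z2 + 2 * x2));
      Z2xZ4_entry 2 GZ2xZ4 (fun '(x1, y1) '(x2, y2) =>
        red24 (x1 + x2) (y1 + y2 + 2 * x1 * x2 + 2 * y1 * y2));
      Z2xZ4_entry 2 GD4 (fun '(x1, y1) '(x2, y2) =>
        red24 (x1 + x2) (y1 + y2 + 2 * (x1 + y1) * x2 + 2 * y1 * y2));
      Z2xZ4_entry 2 GZ2xZ4 (fun '(x1, y1) '(x2, y2) =>
        red24 (x1 + x2) (y1 + y2 + 2 * y1 * x2 + 2 * x1 * y2));
      Z2xZ4_entry 2 GZ2xZ2xZ2 (fun '(x1, y1) '(x2, y2) =>
        red24 (x1 + x2) (y1 + y2 + 2 * y1 * x2 + 2 * (x1 + y1) * y2));
      Z2xZ4_entry 2 GZ2xZ4 (fun '(x1, y1) '(x2, y2) =>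
        red24 (x1 + x2 + y1 * y2) (y1 + y2 + 2 * y1 * x2 + 2 * x1 * y2));
      Z2xZ4_entry 2 GD4 (fun '(x1, y1) '(x2, y2) =>
        red24 (x1 + x2 + y2 * \sum_(1 <= i < y1) i) (y1 + y2 + 2 * y1 * y2));
      Z2xZ4_entry 4 GD4 (fun '(x1, y1) '(x2, y2) =>
        red24 (x1 + x2) (y1 + y2 + 2 * x1 * y2));
      Z2xZ4_entry 4 GZ2xZ2xZ2 (fun '(x1, y1) '(x2, y2) =>
        red24 (x1 + x2) (y1 + y2 + 2 * y1 * y2));
      Z2xZ4_entry 4 GD4 (fun '(x1, y1) '(x2, y2) =>
        red24 (x1 + x2) (y1 + y2 + 2 * y1 * x2));
      Z2xZ4_entry 4 GZ2xZ4 (fun '(x1, y1) '(x2, y2) =>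
        red24 (x1 + x2) (y1 + y2 + 2 * x1 * x2));
      Z2xZ4_entry 4 GQ (fun '(x1, y1) '(x2, y2) =>
        red24 (x1 + x2) (y1 + y2 + 2 * (x1 + y1) * x2));
      Z2xZ4_entry 4 GZ2xZ4 (fun '(x1, y1) '(x2, y2) =>
        red24 (x1 + x2 + y1 * y2) (y1 + y2));
      Z2xZ4_entry 8 GZ2xZ4 (fun '(x1, y1) '(x2, y2) =>
        red24 (x1 + x2) (y1 + y2))].

Definition braces_Z2xZ2xZ2 : seq brace_entry :=
  [:: Z2xZ2xZ2_entry 1 GD4 (fun '(x1, y1, z1) '(x2, y2, z2) =>
        (x1 + x2 + z1 * y2 + x1 * z2 + y1 * z2 + x1 * z1 * z2,
         y1 + y2 + z1 * z2 + x1 * z2 + y1 * z1 * z2, z1 + z2));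
      Z2xZ2xZ2_entry 2 GZ2xZ2xZ2 (fun '(x1, y1, z1) '(x2, y2, z2) =>
        (x1 + x2 + z1 * y2 + y1 * z2, y1 + y2, z1 + z2));
      Z2xZ2xZ2_entry 2 GZ2xZ4 (fun '(x1, y1, z1) '(x2, y2, z2) =>
        (x1 + x2 + y1 * y2 + z1 * z2, y1 + y2, z1 + z2));
      Z2xZ2xZ2_entry 2 GQ (fun '(x1, y1, z1) '(x2, y2, z2) =>
        (x1 + x2 + (y1 + z1) * y2 + z1 * z2, y1 + y2, z1 + z2));
      Z2xZ2xZ2_entry 2 GZ2xZ4 (fun '(x1, y1, z1) '(x2, y2, z2) =>
        (x1 + x2 + z1 * y2 + y1 * z2, y1 + y2 + z1 * z2, z1 + z2));
      Z2xZ2xZ2_entry 4 GZ2xZ4 (fun '(x1, y1, z1) '(x2, y2, z2) =>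
        (x1 + x2 + y1 * y2, y1 + y2, z1 + z2));
      Z2xZ2xZ2_entry 4 GD4 (fun '(x1, y1, z1) '(x2, y2, z2) =>
        (x1 + x2 + z1 * y2, y1 + y2, z1 + z2));
      Z2xZ2xZ2_entry 8 GZ2xZ2xZ2 (fun '(x1, y1, z1) '(x2, y2, z2) =>
        (x1 + x2, y1 + y2, z1 + z2))].

Definition braces8 : seq brace_entry :=
  braces_Z8 ++ braces_Z2xZ4 ++ braces_Z2xZ2xZ2.

Definition brace8 (i : 'I_(size braces8)) : brace_entry :=
  tnth (in_tuple braces8) i.

(* Main.v *)
(** Write a left brace on an abelian group [A] as [a . b = a + lambda_a b].
    Each [lambda_a] is an automorphism of [A], and associativity says
    [lambda_(a + lambda_a b) = lambda_a \o lambda_b].  Hence the values of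
    [lambda] at a few elements determine it on the subgroup of [(A, .)] that
    they generate, and all braces on [A] are found by a backtracking search:
    pick an element where [lambda] is still unknown, try every automorphism of
    [A] there, and close up.  For each of the three abelian groups of order 8,
    every leaf of this search is matched with a formula of the list by some
    automorphism of [A].  No automorphism matches two different formulas. *)

From HB Require Import structures.
Require Import Defs.
From mathcomp Require Import all_boot all_order all_algebra all_fingroup.
From mathcomp Require Import all_solvable.
Set Implicit Arguments.
Unset Strict Implicit.
Unset Printing Implicit Defensive.
Import GRing.Theory.

(** * Abelian groups of order eight *)

Section AbelianOrder8.
Local Open Scope ring_scope.

Lemma inj_of_trivial_ker (A B : zmodType) (f : A -> B) :
  {morph f : x y / x + y} -> (forall x, f x = 0 -> x = 0) -> injective f.
Proof.
move=> fD f0 x y fxy; apply/eqP; rewrite -subr_eq0; apply/eqP/f0.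
by apply: (addIr (f y)); rewrite -fD subrK add0r.
Qed.

(** Translation by [x] permutes [B], so it fixes the sum of all elements, yet it adds [x *+ #|B|] to
    that sum. *)
Lemma mulr_card_eq0 (B : finZmodType) (x : B) : x *+ #|B| = 0.
Proof.
apply: (addIr (\sum_(b : B) b)); rewrite add0r [RHS](reindex_inj (addrI x)).
by rewrite big_split /= sumr_const.
Qed.

Lemma mulrn_mod (B : zmodType) (x : B) n m :
  x *+ n = 0 -> x *+ (m %% n) = x *+ m.
Proof.
move=> xn; rewrite [in RHS](divn_eq m n) mulrnDr mulnC mulrnA xn mul0rn.
by rewrite add0r.
Qed.

Lemma mulrn_Zp_morph (B : zmodType) (x : B) n :
  x *+ n.+2 = 0 -> {morph (fun a : 'Z_n.+2 => x *+ a) : a b / a + b}.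
Proof. by move=> xn a b; rewrite -mulrnDr -[RHS](mulrn_mod _ xn). Qed.

Lemma exists_notin (T : finType) (s : seq T) :
  (size s < #|T|)%N -> exists x, x \notin s.
Proof.
move=> lt_s; apply/existsP; apply: contraLR lt_s => /existsPn s_all.
rewrite -leqNgt; apply: leq_trans (card_size s); apply: subset_leq_card.
by apply/subsetP=> x _; apply: negbNE.
Qed.

Lemma add_morph_pair (A A' B : zmodType) (f : A -> B) (g : A' -> B) :
  {morph f : x y / x + y} -> {morph g : x y / x + y} ->
  {morph (fun p => f p.1 + g p.2) : p q / p + q}.
Proof. by move=> fD gD p q /=; rewrite fD gD addrACA. Qed.

Lemma additive_iso_inj (k : additive8) (B : finZmodType)
    (f : additive_group k -> B) : #|B| = 8%N ->
  {morph f : x y / x + y} -> (forall x, f x = 0 -> x = 0) ->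
  exists k (f : additive_group k -> B),
    bijective f /\ {morph f : x y / x + y}.
Proof.
move=> oB fD f0; exists k, f; split=> //.
apply: inj_card_bij; first exact: inj_of_trivial_ker.
by rewrite oB; case: (k); rewrite ?card_prod !card_ord.
Qed.

Lemma mulrn_order4_eq0 (B : zmodType) (y : B) (b : nat) :
  y *+ 4 = 0 -> y *+ 2 != 0 -> y *+ b = 0 -> (b = 0 %[mod 4])%N.
Proof.
move=> y4 y2 yb; have: y *+ (b %% 4) = 0 by rewrite mulrn_mod.
have: (b %% 4 < 4)%N by rewrite ltn_mod.
case: (b %% 4)%N => [|[|[|[|//]]]] // _ y0; case/eqP: y2.
- by rewrite -[y]mulr1n y0 mul0rn.
- by rewrite y0.
(* In this case [y *+ 3 = 0]; since 6 is 2 modulo 4, [y *+ 2] is twice [y *+ 3]. *)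
- by rewrite (mulrn_mod 6 y4) (mulrnA y 3 2) y0 mul0rn.
Qed.

(** The cases follow the exponent of [B]. Exponent 8 gives a cyclic group, exponent 4 an element [y]
    of order 4 with an involution outside its span, exponent 2 a vector space of dimension 3 over
    the field with two elements. *)
Theorem abelian_order8 (B : finZmodType) : #|B| = 8%N ->
  exists k (f : additive_group k -> B),
    bijective f /\ {morph f : x y / x + y}.
Proof.
move=> oB; have x8 (x : B) : x *+ 8 = 0 by rewrite -oB mulr_card_eq0.
have [/existsP[x nx4]|/existsPn all4] := boolP [exists x : B, x *+ 4 != 0].
  apply: (@additive_iso_inj AZ8 B (fun a : 'Z_8 => x *+ a)) => //.
    exact: mulrn_Zp_morph (x8 x).
  move=> a xa; apply/val_inj => /=; move: xa; case: a => a /= lt_a xa.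
  apply/eqP; apply: contraNT nx4 => a0.
  (* Every nonzero [a] modulo 8 has a multiple equal to 4, so [x *+ a = 0] would force
     [x *+ 4 = 0]. *)
  have [c /eqP acE] : exists c, ((a * c) %% 8 == 4)%N.
    case: a lt_a {xa} a0 => [|[|[|[|[|[|[|[|//]]]]]]]] // _ _.
    - by exists 4. - by exists 2. - by exists 4. - by exists 1.
    - by exists 4. - by exists 2. - by exists 4.
  by rewrite -acE (mulrn_mod _ (x8 x)) mulrnA xa mul0rn.
have {}all4 (x : B) : x *+ 4 = 0 by apply/eqP; rewrite -[_ == _]negbK all4.
have [/existsP[y ny2]|/existsPn all2] := boolP [exists y : B, y *+ 2 != 0].
  have yE b : y *+ b = 0 -> (b = 0 %[mod 4])%N by apply: mulrn_order4_eq0.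
  have [x0 x0P] : exists x : B, forall b, x + y *+ b != 0.
    have [|x xP] := @exists_notin B [seq - (y *+ b) | b <- iota 0 4].
      by rewrite oB.
    exists x => b; apply: contraNneq xP => /eqP; rewrite addr_eq0 => /eqP ->.
    rewrite -(mulrn_mod b (all4 y)) (map_f (fun b => - (y *+ b))) //.
    by rewrite mem_iota ltn_mod.
  (* [x0] may itself have order 4. A nontrivial relation [x0 *+ a + y *+ b = 0] shows that [x0] or
     [x0 + y] is the required involution. *)
  have [x [x2 xP]] : exists x : B, x *+ 2 = 0 /\ forall b, x + y *+ b != 0.
    have gD := add_morph_pair (@mulrn_Zp_morph B x0 2 (all4 x0))
      (@mulrn_Zp_morph B y 2 (all4 y)).
    set g := fun p => _ in gD.
    (* Pigeonhole: 16 pairs are sent to 8 elements. The difference of two colliding pairs is the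
       relation. *)
    have /injectivePn[p [q npq gpq]] : ~~ injectiveb (g : 'Z_4 * 'Z_4 -> B).
      apply/injectiveP=> /leq_card; rewrite oB card_prod !card_ord.
      by [].
    have {npq}d0 : p - q != 0 by rewrite subr_eq0.
    have {gpq}gd : g (p - q) = 0.
      by apply: (addIr (g q)); rewrite -gD subrK add0r.
    case: (p - q) d0 gd => a b; rewrite /g /=; case: a => a lt_a; rewrite /=.
    move=> ab0 gab.
    case: a lt_a ab0 gab => [|[|[|[|//]]]] // lt_a ab0 gab.
    - case/eqP: ab0; congr (_, _); apply: val_inj => //=.
      by move: gab; rewrite mulr0n add0r => /yE; rewrite !modn_small.
    - by have := x0P b; rewrite -gab mulr1n eqxx.
    (* For [a = 2], doubling the relation shows that [b] is 0 or 2. The witness is [x0] in the first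
       case and [x0 + y] in the second. *)
    - have: y *+ (b * 2) = 0.
        by rewrite mulrnA -[_ *+ 2]add0r -[X in X + _](all4 x0)
          (mulrnA x0 2 2) -mulrnDl gab mul0rn.
      move/yE; case: b gab {ab0} => -[|[|[|[|//]]]] //= _ gab _.
        by exists x0; split=> //; rewrite mulr0n addr0 in gab.
      exists (x0 + y); split=> [|b]; first by rewrite mulrnDl.
      by rewrite -addrA -mulrS x0P.
    (* For [a = 3], tripling the relation makes [x0 = x0 *+ 9] a multiple of [y]. *)
    - have := x0P (b * 3)%N; rewrite mulrnA.
      have -> : x0 = (x0 *+ 3) *+ 3.
        by rewrite -mulrnA -(mulrn_mod 9 (all4 x0)) mulr1n.
      by rewrite -mulrnDl gab mul0rn eqxx.
  apply: (@additive_iso_inj AZ2xZ4 B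
    (fun p : Z2xZ4 => x *+ p.1 + y *+ p.2)) => //.
    exact: (add_morph_pair (@mulrn_Zp_morph B x 0 x2)
      (@mulrn_Zp_morph B y 2 (all4 y))).
  move=> [[[|[|//]] lt_a] b] /= => [|/eqP].
    rewrite mulr0n add0r => /yE; rewrite !modn_small // => b0.
    by congr (_, _); apply: val_inj.
  by rewrite mulr1n (negPf (xP b)).
have {}all2 (x : B) : x *+ 2 = 0 by apply/eqP; rewrite -[_ == _]negbK all2.
have oppE (x : B) : - x = x.
  by apply/eqP; rewrite eq_sym -addr_eq0 -mulr2n all2.
(* Each of [x], [y], [z] is taken outside the span of the previous ones, so the three form a
   basis. *)
have [|x] := @exists_notin B [:: 0]; first by rewrite oB.
rewrite !inE => nx0.
have [|y] := @exists_notin B [:: 0; x]; first by rewrite oB.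
rewrite !inE => /norP[ny0 nyx].
have [|z] := @exists_notin B [:: 0; x; y; x + y]; first by rewrite oB.
rewrite !inE => /norP[nz0 /norP[nzx /norP[nzy nzxy]]].
apply: (@additive_iso_inj AZ2xZ2xZ2 B
  (fun p : Z2xZ2xZ2 => x *+ p.1.1 + y *+ p.1.2 + z *+ p.2)) => //.
  exact: (add_morph_pair
    (add_morph_pair (@mulrn_Zp_morph B x 0 (all2 x))
      (@mulrn_Zp_morph B y 0 (all2 y))) (@mulrn_Zp_morph B z 0 (all2 z))).
move=> [[[[|[|//]] lt_a] [[|[|//]] lt_b]] [[|[|//]] lt_c]] /=.
- by move=> _; do 2?congr (_, _); apply: val_inj.
all: rewrite !(mulr0n, mulr1n) ?add0r ?addr0 => /eqP;
  rewrite ?addr_eq0 ?oppE;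
  by rewrite ?(negPf nx0) ?(negPf ny0) ?(negPf nz0) 1?eq_sym ?(negPf nyx)
    ?(negPf nzx) ?(negPf nzy) ?(negPf nzxy).
Qed.

End AbelianOrder8.

(** * Structures coded on {0, ..., 7} *)

Definition codes := iota 0 8.
Definition table (op : nat -> nat -> nat) : seq (seq nat) :=
  [seq [seq op i j | j <- codes] | i <- codes].
Definition look (T : seq (seq nat)) (i j : nat) : nat := nth 0 (nth [::] T i) j.

(* The product of [x ^ a y ^ b], coded as [4 a + b], and [x ^ c y ^ d] in the
   group given by [y ^ 4 = 1], [y x = x y ^ u] and [x ^ 2 = y ^ v]. *)
Definition ext_op (u v i j : nat) : nat :=
  let a := i %/ 4 in let b := i %% 4 in let c := j %/ 4 in let d := j %% 4 in
  4 * ((a + c) %% 2) + (b * u ^ c + d + v * a * c) %% 4.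

Definition grp_op (t : group8) : nat -> nat -> nat :=
  match t with
  | GZ8 => fun i j => (i + j) %% 8
  | GZ2xZ4 => ext_op 1 0
  | GZ2xZ2xZ2 => fun i j =>
      4 * ((i %/ 4 + j %/ 4) %% 2) + 2 * ((i %/ 2 + j %/ 2) %% 2)
      + (i + j) %% 2
  | GD4 => ext_op 3 0
  | GQ => ext_op 3 2
  end.

(** Splitting by [match] lets all five tables be evaluated once, at definition time; later products
    are lookups. *)
Definition grp_table : group8 -> seq (seq nat) := Eval vm_compute in
  fun t => match t with
  | GZ8 => table (grp_op GZ8)
  | GZ2xZ4 => table (grp_op GZ2xZ4)
  | GZ2xZ2xZ2 => table (grp_op GZ2xZ2xZ2)
  | GD4 => table (grp_op GD4)
  | GQ => table (grp_op GQ)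
  end.

Definition grp (t : group8) := look (grp_table t).

Definition generators (t : group8) : nat * nat * nat :=
  match t with
  | GZ8 => (1, 0, 0) | GZ2xZ2xZ2 => (4, 2, 1) | _ => (4, 1, 0)
  end.

(* The exponents of [x ^ e1 y ^ e2 z ^ e3], coded as [i], on the
   [generators]. *)
Definition normal_form (t : group8) (i : nat) : nat * nat * nat :=
  match t with
  | GZ8 => (i, 0, 0)
  | GZ2xZ2xZ2 => (i %/ 4, i %/ 2 %% 2, i %% 2)
  | _ => (i %/ 4, i %% 4, 0)
  end.

Definition word (op : nat -> nat -> nat) (u e : nat * nat * nat) : nat :=
  op (iter e.1.1 (op u.1.1) 0)
     (op (iter e.1.2 (op u.1.2) 0) (iter e.2 (op u.2) 0)).

(** A place of [generators] that holds no generator contains 0 and must go to 0, whence the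
    singleton ranges. *)
Definition gen_images (t : group8) : seq (nat * nat * nat) :=
  let s2 := if t is GZ8 then [:: 0] else codes in
  let s3 := if t is GZ2xZ2xZ2 then codes else [:: 0] in
  [seq (uv, w) | uv <- [seq (u, v) | u <- codes, v <- s2], w <- s3].

(* [vm_compute] evaluates both arguments of the connectives in [all] and [has];
   these variants stop at the first witness. *)
Fixpoint all_if (T : Type) (P : pred T) (s : seq T) : bool :=
  if s is x :: s' then if P x then all_if P s' else false else true.
Fixpoint has_if (T : Type) (P : pred T) (s : seq T) : bool :=
  if s is x :: s' then if P x then true else has_if P s' else false.

Lemma all_ifE T (P : pred T) s : all_if P s = all P s.
Proof. by elim: s => //= x s ->; case: (P x). Qed.

Lemma has_ifE T (P : pred T) s : has_if P s = has P s.
Proof. by elim: s => //= x s ->; case: (P x). Qed.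

(** Rows are tried from the last one down: the row of the identity 0 cannot refute a map of groups
    that fixes 0. *)
Definition hom_table (op1 op2 : nat -> nat -> nat) (M : seq nat) : bool :=
  all_if (fun i => all_if (fun j =>
    nth 0 M (op1 i j) == op2 (nth 0 M i) (nth 0 M j)) codes) (rev codes).

Definition iso_table (op1 op2 : nat -> nat -> nat) (M : seq nat) : bool :=
  [&& size M == 8, uniq M, all (gtn 8) M & hom_table op1 op2 M].

(* A homomorphism is determined by the images of the generators, so this lists
   all isomorphisms from the group [grp t] onto [op]. *)
Definition isos (t : group8) (op : nat -> nat -> nat) : seq (seq nat) :=
  [seq M <- [seq [seq word op u (normal_form t i) | i <- codes]
            | u <- gen_images t]
  | iso_table (grp t) op M].

(** * Backtracking search for the maps lambda *)

Section Search.
Variables (add : nat -> nat -> nat) (auts : seq (seq nat)).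
Variable leaf : seq (seq nat) -> bool.

(* [nth [::] P i] is the table of [lambda_i], or [::] if [lambda_i] is still
   unknown; [None] signals a contradiction. *)
Definition close_pair (i j : nat) (P : seq (seq nat)) :
    option (seq (seq nat)) :=
  let M := nth [::] P i in let N := nth [::] P j in
  if nilp M || nilp N then Some P else
  let c := add i (nth 0 M j) in
  let L := [seq nth 0 M k | k <- N] in
  let K := nth [::] P c in
  if nilp K then Some (set_nth [::] P c L) else
  if K == L then Some P else None.

Fixpoint close_pairs (s : seq (nat * nat)) (P : seq (seq nat)) :=
  if s is ij :: s' then
    if close_pair ij.1 ij.2 P is Some P' then close_pairs s' P' else None
  else Some P.

Definition all_pairs : seq (nat * nat) :=
  [seq (i, j) | i <- behead codes, j <- behead codes].

(* The new element [a] comes first: most choices of [lambda_a] already fail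
   there. *)
Definition rounds (a : nat) : seq (nat * nat) :=
  [seq (a, j) | j <- codes] ++ [seq (j, a) | j <- codes]
  ++ all_pairs ++ all_pairs.

(** Exhausted fuel yields [false], so it can never validate an incomplete search. Each level fills
    at least one of the eight places. *)
Fixpoint search (n : nat) (P : seq (seq nat)) : bool :=
  if n is n'.+1 then
    let a := find (@nilp _) P in
    if a < 8 then
      all (fun M => if close_pairs (rounds a) (set_nth [::] P a M) is Some P'
                    then search n' P' else true) auts
    else leaf P
  else false.
End Search.

(* Only [lambda_0 = id] is known at the start. *)
Definition start : seq (seq nat) := codes :: nseq 7 [::].

(** * Tables of the listed formulas *)

Section EntryTables.
Local Open Scope ring_scope.

(** Mixed-radix digits, the first factor being the most significant; the casts reduce each digit.
    This is the coding used in [grp_op], so the table of the abelian group is also the addition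
    table. *)
Definition dec (k : additive8) : nat -> additive_group k :=
  match k with
  | AZ8 => fun i => i%:R : 'Z_8
  | AZ2xZ4 => fun i => ((i %/ 4)%:R, i%:R) : Z2xZ4
  | AZ2xZ2xZ2 => fun i => ((i %/ 4)%:R, (i %/ 2)%:R, i%:R) : Z2xZ2xZ2
  end.

Definition enc (k : additive8) : additive_group k -> nat :=
  match k with
  | AZ8 => fun x : 'Z_8 => x
  | AZ2xZ4 => fun x : Z2xZ4 => (4 * x.1 + x.2)%N
  | AZ2xZ2xZ2 => fun x : Z2xZ2xZ2 => (4 * x.1.1 + 2 * x.1.2 + x.2)%N
  end.

Definition op_table (E : brace_entry) : seq (seq nat) :=
  table (fun i j => enc (entry_mul E (dec _ i) (dec _ j))).

(* Big operators are opaque, so the sum in entry 11 does not compute; the closed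
   form of that sum does. *)
Definition op_tables : seq (seq (seq nat)) := Eval vm_compute in
  [seq op_table E | E <- set_nth (Z8_entry 8 GZ8 +%R) braces8 11
    (Z2xZ4_entry 2 GD4 (fun '(x1, y1) '(x2, y2) =>
       red24 (x1 + x2 + y2 * 'C(y1, 2)) (y1 + y2 + 2 * y1 * y2)))].

(** Unlocking the big operator makes the original sum evaluate, which justifies its replacement by
    ['C(y1, 2)]. *)
Lemma map_op_table : map op_table braces8 = op_tables.
Proof. by rewrite /braces8 /braces_Z2xZ4 unlock; vm_compute. Qed.

End EntryTables.

Lemma mem_codes i : (i \in codes) = (i < 8).
Proof. by rewrite mem_iota. Qed.

Lemma all_codesP (P : pred nat) :
  reflect (forall i, i < 8 -> P i) (all P codes).
Proof. by apply: (iffP allP) => Pi i; have := Pi i; rewrite mem_codes. Qed.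

Lemma nth_codes (T : Type) (x : T) (F : nat -> T) i :
  i < 8 -> nth x [seq F j | j <- codes] i = F i.
Proof. by move=> lt_i; rewrite (nth_map 0) ?size_iota // nth_iota. Qed.

Lemma look_table op i j : i < 8 -> j < 8 -> look (table op) i j = op i j.
Proof. by move=> lt_i lt_j; rewrite /look /table !nth_codes. Qed.

Lemma hom_tableP op1 op2 M :
  reflect (forall i j, i < 8 -> j < 8 ->
             nth 0 M (op1 i j) = op2 (nth 0 M i) (nth 0 M j))
          (hom_table op1 op2 M).
Proof.
rewrite /hom_table all_ifE all_rev.
apply: (iffP (all_codesP _)) => [homM i j lt_i lt_j | homM i lt_i].
  by move: (homM i lt_i); rewrite all_ifE => /all_codesP/(_ j lt_j)/eqP.
by rewrite all_ifE; apply/all_codesP=> j lt_j; rewrite homM.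
Qed.

Lemma grp_lt t i j : i < 8 -> j < 8 -> grp t i j < 8.
Proof.
have: all (fun i => all (fun j => grp t i j < 8) codes) codes.
  by case: t; vm_compute.
by move=> /all_codesP grpt /grpt/all_codesP; apply.
Qed.

Lemma grp_word t i :
  i < 8 -> word (grp t) (generators t) (normal_form t i) = i.
Proof.
have: all (fun i => word (grp t) (generators t) (normal_form t i) == i) codes.
  by case: t; vm_compute.
by move=> /all_codesP grpt /grpt/eqP.
Qed.

(** Completeness of the enumeration: [F] carries the normal form of [i] to the same word in the
    images of the generators, so its table is among the candidates. *)
Lemma mem_isos t op (F : nat -> nat) :
    (forall i, i < 8 -> F i < 8) ->
    {in codes &, injective F} -> F 0 = 0 ->
    (forall i j, i < 8 -> j < 8 -> F (grp t i j) = op (F i) (F j)) ->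
  [seq F i | i <- codes] \in isos t op.
Proof.
move=> ltF injF F0 FM; rewrite mem_filter; apply/andP; split.
  apply/and4P; split; first by rewrite size_map.
  - by rewrite map_inj_in_uniq ?iota_uniq.
  - by rewrite all_map; apply/all_codesP.
  - by apply/hom_tableP=> i j lt_i lt_j; rewrite !nth_codes ?grp_lt // FM.
pose g := generators t; pose Fg := (F g.1.1, F g.1.2, F g.2).
have [lt_g1 [lt_g2 lt_g3]] : g.1.1 < 8 /\ g.1.2 < 8 /\ g.2 < 8.
  by rewrite /g; case: (t).
have FX u n : u < 8 ->
    iter n (grp t u) 0 < 8 /\ F (iter n (grp t u) 0) = iter n (op (F u)) 0.
  by move=> lt_u; elim: n => //= n [lt_n <-]; rewrite grp_lt // FM.
apply/mapP; exists Fg.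
  rewrite /gen_images; apply: (allpairs_f pair); first apply: (allpairs_f pair).
  - by rewrite mem_codes ltF.
  - by move: (ltF _ lt_g2); rewrite /g; case: (t); rewrite ?mem_codes //= F0.
  - by move: (ltF _ lt_g3); rewrite /g; case: (t); rewrite ?mem_codes //= F0.
apply/eq_in_map => i; rewrite mem_codes => lt_i.
rewrite -[in LHS](grp_word t lt_i) /word -/g.
have [lt1 E1] := FX _ (normal_form t i).1.1 lt_g1.
have [lt2 E2] := FX _ (normal_form t i).1.2 lt_g2.
have [lt3 E3] := FX _ (normal_form t i).2 lt_g3.
by rewrite !FM ?grp_lt // E1 E2 E3.
Qed.

(** * Passing between maps and their tables *)

Section Coding.

Definition coding (T : Type) (d : nat -> T) (e : T -> nat) : Prop :=
  [/\ forall x, e x < 8, cancel e d & forall i, i < 8 -> e (d i) = i].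

Definition coded (T : Type) (op : T -> T -> T) (d : nat -> T) (e : T -> nat)
    (m : nat -> nat -> nat) : Prop :=
  forall i j, i < 8 -> j < 8 -> e (op (d i) (d j)) = m i j.

Lemma codedE T op (d : nat -> T) e m : coding d e -> coded op d e m ->
  forall x y, e (op x y) = m (e x) (e y).
Proof. by move=> [lt_e eK _] opm x y; rewrite -opm // !eK. Qed.

Variables (S T : Type) (dS : nat -> S) (eS : S -> nat).
Variables (dT : nat -> T) (eT : T -> nat).
Hypotheses (codS : coding dS eS) (codT : coding dT eT).

Definition decode_map (M : seq nat) (x : S) : T := dT (nth 0 M (eS x)).

(** Eight distinct values below 8 form a permutation of [codes], whose inverse is given by
    [index]. *)
Lemma decode_map_bij M :
  size M = 8 -> uniq M -> all (gtn 8) M -> bijective (decode_map M).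
Proof.
case: codS codT => ltS SK dSK [ltT TK dTK] sM uM aM.
have memM i : (i \in M) = (i < 8).
  have [_ ->] : (size M = size codes) * (M =i codes); last exact: mem_codes.
    apply: uniq_min_size => //; last by rewrite sM.
    by move=> j /(allP aM) /=; rewrite mem_codes.
exists (fun y => dS (index (eT y) M)) => [x | y] /=.
  rewrite /decode_map dTK; first by rewrite index_uniq ?sM.
  by rewrite -memM mem_nth ?sM.
rewrite /decode_map dSK; first by rewrite nth_index // memM.
by rewrite -sM index_mem memM.
Qed.

Lemma decode_map_morph opS opT mS mT M :
  coded opS dS eS mS -> coded opT dT eT mT -> all (gtn 8) M -> size M = 8 ->
  hom_table mS mT M -> {morph decode_map M : x y / opS x y >-> opT x y}.
Proof.
move=> cS cT aM sM /hom_tableP homM x y.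
case: (codS) (codT) => ltS SK dSK [ltT TK dTK].
rewrite /decode_map (codedE codS cS) homM // -cT ?TK //.
  by apply: (allP aM); rewrite mem_nth ?sM.
by apply: (allP aM); rewrite mem_nth ?sM.
Qed.

Variable f : S -> T.
Definition encode_map : nat -> nat := fun i => eT (f (dS i)).

Lemma encode_map_lt i : encode_map i < 8.
Proof. by have [lt_e _ _] := codT; apply: lt_e. Qed.

Lemma encode_map_inj : injective f -> {in codes &, injective encode_map}.
Proof.
case: codS codT => ltS SK dSK [ltT TK dTK] injf i j.
rewrite !mem_codes => lti ltj.
by move/(can_inj TK)/injf/(congr1 eS); rewrite !dSK.
Qed.

Lemma encode_map_hom opS opT mS mT :
  coded opS dS eS mS -> coded opT dT eT mT ->
  {morph f : x y / opS x y >-> opT x y} ->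
  forall i j, i < 8 -> j < 8 ->
    encode_map (mS i j) = mT (encode_map i) (encode_map j).
Proof.
case: (codS) => ltS SK dSK cS cT fM i j lti ltj.
by rewrite /encode_map -(codedE codT cT) -fM -(cS i j) // SK.
Qed.

End Coding.

(** * Soundness of the search *)

Section SearchSound.
Variables (add : nat -> nat -> nat) (auts : seq (seq nat)).
Variable leaf : seq (seq nat) -> bool.
Variable lam : nat -> seq nat.
Hypothesis lam_auts : forall i, i < 8 -> lam i \in auts.
Hypothesis lam_add : forall i j, i < 8 -> j < 8 -> add i (nth 0 (lam i) j) < 8.
Hypothesis lamM : forall i j, i < 8 -> j < 8 ->
  lam (add i (nth 0 (lam i) j)) = [seq nth 0 (lam i) k | k <- lam j].

(** The invariant of the branch that follows the actual [lam]: whatever is filled in is correct. *)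
Definition agrees (P : seq (seq nat)) : Prop :=
  size P = 8 /\
  forall i, i < 8 -> nth [::] P i = [::] \/ nth [::] P i = lam i.

Lemma agrees_set P i :
  i < 8 -> agrees P -> agrees (set_nth [::] P i (lam i)).
Proof.
move=> lt_i [sP agP]; split; first by rewrite size_set_nth sP (maxn_idPr lt_i).
move=> j lt_j; rewrite nth_set_nth /=.
by case: eqP => [->|_]; [right | apply: agP].
Qed.

(** By [lamM] the computed composite is the true value at [c], so it cannot clash with a place
    already filled. *)
Lemma close_pair_sound i j P : i < 8 -> j < 8 -> agrees P ->
  exists2 P', close_pair add i j P = Some P' & agrees P'.
Proof.
move=> lt_i lt_j agP; rewrite /close_pair.
have [_ ag] := agP; have lt_c := lam_add lt_i lt_j.
case: (ag i lt_i) => -> /=; first by exists P.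
case: (ag j lt_j) => -> /=; first by rewrite orbT; exists P.
case: ifP => _; first by exists P.
rewrite -lamM //; case: (ag _ lt_c) => -> /=.
  by eexists; [by [] | exact: agrees_set].
by rewrite eqxx; case: ifP => _; eexists; (by [] || exact: agrees_set || by []).
Qed.

Lemma close_pairs_sound s P :
    (forall ij, ij \in s -> ij.1 < 8 /\ ij.2 < 8) -> agrees P ->
  exists2 P', close_pairs add s P = Some P' & agrees P'.
Proof.
elim: s P => [|ij s IHs] P lt_s agP /=; first by exists P.
have [lt1 lt2] := lt_s ij (mem_head _ _).
have [P' -> agP'] := close_pair_sound lt1 lt2 agP.
by apply: IHs => // kl s_kl; apply: lt_s; rewrite inE s_kl orbT.
Qed.

Lemma all_pairs_lt ij : ij \in all_pairs -> ij.1 < 8 /\ ij.2 < 8.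
Proof.
by case/allpairsP=> p [/mem_behead + /mem_behead + ->]; rewrite !mem_codes.
Qed.

Lemma rounds_lt a ij : a < 8 -> ij \in rounds a -> ij.1 < 8 /\ ij.2 < 8.
Proof.
move=> lt_a; rewrite mem_cat => /orP[|].
  by case/mapP=> j; rewrite mem_codes => lt_j -> /=.
rewrite mem_cat => /orP[|].
  by case/mapP=> j; rewrite mem_codes => lt_j -> /=.
by rewrite mem_cat => /orP[]; apply: all_pairs_lt.
Qed.

Lemma searchS n P : search add auts leaf n.+1 P =
  if find (@nilp _) P < 8 then
    all (fun M => if close_pairs add (rounds (find (@nilp _) P))
                       (set_nth [::] P (find (@nilp _) P) M) is Some P'
                  then search add auts leaf n P' else true) auts
  else leaf P.
Proof. by []. Qed.

(** Every branch has been checked, in particular the one that guesses [lam a] at each unknown [a].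
    It is never cut off, and its leaf is the full table of [lam]. *)
Lemma search_sound n P :
  agrees P -> search add auts leaf n P -> leaf [seq lam i | i <- codes].
Proof.
elim: n P => [//|n IHn] P agP; rewrite searchS; have [sP ag] := agP.
case: ifP => [lt_a /allP/(_ _ (lam_auts lt_a)) | ge_a].
  have [P' -> agP'] := close_pairs_sound (fun ij => @rounds_lt _ ij lt_a)
    (agrees_set lt_a agP).
  exact: IHn.
suff -> : P = [seq lam i | i <- codes] by [].
apply: (@eq_from_nth _ [::]) => [|i]; rewrite ?size_map // sP => lt_i.
rewrite nth_codes //; have [Pi|//] := ag i lt_i.
by case/negP: (negbT ge_a); rewrite -sP -has_find; apply/(has_nthP [::]);
  exists i; rewrite ?sP // Pi.
Qed.

End SearchSound.

(** * Groups of order eight *)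

Definition additive_type (k : additive8) : group8 :=
  match k with
  | AZ8 => GZ8 | AZ2xZ4 => GZ2xZ4 | AZ2xZ2xZ2 => GZ2xZ2xZ2
  end.

Lemma coding_dec k : coding (@dec k) (@enc k).
Proof.
have codP : all (fun i => enc (dec k i) == i) codes by case: k; vm_compute.
split; last by move=> i lt_i; apply/eqP; exact: (all_codesP _ codP).
- case: k {codP} => [a|[a b]|[[a b] c]] /=; first exact: ltn_ord.
  + by case: a b => -[|[|//]] ? [[|[|[|[|//]]]] ?].
  + by case: a b c => -[|[|//]] ? [[|[|//]] ?] [[|[|//]] ?].
- case: k {codP} => [a|[a b]|[[a b] c]] /=; first exact: natr_Zp.
  + by case: a b => -[|[|//]] ? [[|[|[|[|//]]]] ?]; congr (_, _);
      apply: val_inj.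
  + by case: a b c => -[|[|//]] ? [[|[|//]] ?] [[|[|//]] ?]; do 2?congr (_, _);
      apply: val_inj.
Qed.

Lemma coded_add k :
  coded +%R (@dec k) (@enc k) (grp (additive_type k)).
Proof.
have addP : all (fun i => all (fun j =>
    enc (dec k i + dec k j)%R == grp (additive_type k) i j) codes) codes.
  by case: k; vm_compute.
move=> i j lt_i lt_j; apply/eqP.
by have /all_codesP/(_ j lt_j) := all_codesP _ addP i lt_i.
Qed.

(** The parameter tags the type, so that each of the five groups gets its own group structure on
    ['I_8]. *)
Definition table_group (t : group8) : Type := 'I_8.

Section TableGroup.
Variable t : group8.

Definition table_group_dec (i : nat) : table_group t := @inZp 7 i.
Definition table_group_enc (x : table_group t) : nat := nat_of_ord (x : 'I_8).
Definition table_group_mul (x y : table_group t) : table_group t :=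
  table_group_dec (grp t (table_group_enc x) (table_group_enc y)).
(** The column where the row of [x] shows the identity gives a right inverse; [table_group_mulV]
    checks that it is also a left one. *)
Definition table_group_inv (x : table_group t) : table_group t :=
  table_group_dec (index 0 (nth [::] (grp_table t) (table_group_enc x))).

Lemma coding_table_group : coding table_group_dec table_group_enc.
Proof.
split=> [x | x | i lt_i]; first exact: (ltn_ord (x : 'I_8)).
  exact: valZpK.
exact: modn_small.
Qed.

Lemma coded_table_group :
  coded table_group_mul table_group_dec table_group_enc (grp t).
Proof.
have [_ _ dK] := coding_table_group.
by move=> i j lt_i lt_j; rewrite /table_group_mul !dK ?grp_lt.
Qed.

Lemma table_group_mulA : associative table_group_mul.
Proof.
have tA : all (fun i => all (fun j => all (fun k =>
    grp t i (grp t j k) == grp t (grp t i j) k) codes) codes) codes.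
  by case: t; vm_compute.
have [lt_e eK dK] := coding_table_group.
move=> x y z; apply: (can_inj eK).
rewrite !(codedE coding_table_group coded_table_group); apply/eqP.
have /all_codesP/(_ _ (lt_e y)) := all_codesP _ tA _ (lt_e x).
by move/all_codesP/(_ _ (lt_e z)).
Qed.

Lemma table_group_mul1 : left_id (table_group_dec 0) table_group_mul.
Proof.
have t1 : all (fun i => grp t 0 i == i) codes by case: t; vm_compute.
have [lt_e eK dK] := coding_table_group.
move=> x; apply: (can_inj eK).
rewrite (codedE coding_table_group coded_table_group) dK //.
by apply/eqP; exact: (all_codesP _ t1 _ (lt_e x)).
Qed.

Lemma table_group_mulV :
  left_inverse (table_group_dec 0) table_group_inv table_group_mul.
Proof.
have tV : all (fun i => let j := index 0 (nth [::] (grp_table t) i) in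
    (j < 8) && (grp t j i == 0)) codes by case: t; vm_compute.
have [lt_e eK dK] := coding_table_group.
move=> x; apply: (can_inj eK).
rewrite (codedE coding_table_group coded_table_group).
have /andP[lt_j /eqP jx] := all_codesP _ tV _ (lt_e x).
by rewrite !dK.
Qed.

HB.instance Definition _ := Finite.on (table_group t).
HB.instance Definition _ :=
  Finite_isGroup.Build (table_group t)
    table_group_mulA table_group_mul1 table_group_mulV.

Lemma card_table_group : #|[set: table_group t]| = 8.
Proof. by rewrite cardsT card_ord. Qed.

Lemma table_group_encM (x y : table_group t) :
  table_group_enc (x * y)%g = grp t (table_group_enc x) (table_group_enc y).
Proof. exact: (codedE coding_table_group coded_table_group). Qed.

Lemma table_group_encX (x : table_group t) n :
  table_group_enc (x ^+ n)%g = iter n (grp t (table_group_enc x)) 0.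
Proof. by elim: n => // n IHn; rewrite expgS table_group_encM IHn. Qed.

End TableGroup.

(** * Presentations of the dihedral and quaternion groups *)

Section Presentations.
Local Open Scope group_scope.

Lemma table_group_gen t (i j : nat) :
  i < 8 -> j < 8 ->
  all (fun k => has (fun a => has (fun b => k == grp t
     (iter a (grp t i) 0) (iter b (grp t j) 0)) codes) codes) codes ->
  <[table_group_dec t i]> <*> <[table_group_dec t j]> = [set: table_group t].
Proof.
move=> lt_i lt_j /all_codesP gen; apply/eqP; rewrite eqEsubset subsetT /=.
have [lt_e eK dK] := coding_table_group t.
apply/subsetP=> z _; have /hasP[a _ /hasP[b _ /eqP zE]] := gen _ (lt_e z).
have -> : z = table_group_dec t i ^+ a * table_group_dec t j ^+ b.
  by apply: (can_inj eK); rewrite table_group_encM !table_group_encX !dK.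
by rewrite groupM // mem_gen // inE mem_cycle ?orbT.
Qed.

(** [Grp_2dihedral] puts the rotation first and lets the reflection invert it. Exchanging the
    generators gives the present relations, because the inverse of the rotation is its cube. *)
Lemma D4_presentation : [set: table_group GD4] \isog
  Grp (x : y : x ^+ 2 = y ^+ 4 = 1, y * x = x * y ^+ 3).
Proof.
have D8 := Grp_2dihedral (isT : 1 < 3).
have isoD : [set: table_group GD4] \isog [set: 'D_(2 ^ 3)].
  apply/(isoGrpP _ D8); rewrite card_table_group card_2dihedral //; split=> //.
  (* The code 1 is the element of order 4, the code 4 is a reflection. *)
  apply/existsP; exists (table_group_dec GD4 1, table_group_dec GD4 4).
  by rewrite /= !xpair_eqE table_group_gen // eqxx /=; vm_compute.
apply: isoGrp_trans isoD _ => rT H; rewrite D8.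
apply/existsP/existsP=> -[[x y]] /=; rewrite !xpair_eqE => /and4P[defH].
  move=> /eqP x4 /eqP y2 /eqP xy; exists (y, x); rewrite /= !xpair_eqE.
  rewrite joingC defH y2 x4 !eqxx /= conjgC xy; apply/eqP; congr (_ * _).
  by apply/eqP; rewrite eq_invg_mul -expgS x4.
move=> /eqP x2 /eqP y4 /eqP yx; exists (y, x); rewrite /= !xpair_eqE.
rewrite joingC defH y4 x2 !eqxx /= conjgE yx mulKg.
by rewrite eq_sym eq_invg_mul -expgS y4.
Qed.

(** Compared with [Grp_quaternion] there is one more relation, [y ^+ 4 = 1], which follows from the
    others. *)
Lemma Q_presentation : [set: table_group GQ] \isog
   Grp (x : y : x ^+ 2 = y ^+ 2, x ^+ 4 = y ^+ 4 = 1, y^-1 * x * y = x^-1).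
Proof.
have Q8 := Grp_quaternion (isT : 2 < 3).
have isoQ : [set: table_group GQ] \isog [set: 'Q_(2 ^ 3)].
  apply/(isoGrpP _ Q8); rewrite card_table_group card_quaternion //; split=> //.
  apply/existsP; exists (table_group_dec GQ 1, table_group_dec GQ 4).
  by rewrite /= !xpair_eqE table_group_gen // eqxx /=; vm_compute.
apply: isoGrp_trans isoQ _ => rT H; rewrite Q8.
apply/existsP/existsP=> -[[x y]] /=; rewrite !xpair_eqE.
  case/and4P=> /eqP defH /eqP x4 /eqP y2 /eqP xy; exists (x, y).
  rewrite /= !xpair_eqE defH y2 x4 -mulgA -conjgE xy !eqxx /=.
  (* Squaring [y ^+ 2 = x ^+ 2] gives [y ^+ 4 = x ^+ 4 = 1]. *)
  by rewrite andbT -[4]/(2 * 2)%N expgM y2 -expgM; apply/eqP.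
case/and5P=> /eqP defH /eqP x2 /eqP x4 /eqP y4 /eqP xy; exists (x, y).
by rewrite /= !xpair_eqE defH x4 x2 conjgE mulgA xy !eqxx.
Qed.

End Presentations.

Lemma op_isom_sym (S T : Type) (mulS : S -> S -> S) (mulT : T -> T -> T) :
  op_isom mulS mulT -> op_isom mulT mulS.
Proof.
case=> f [g fK gK] fM; exists g; first by exists f.
by move=> x y; apply: (can_inj fK); rewrite fM !gK.
Qed.

Lemma op_isom_coded (S T : Type) dS (eS : S -> nat) dT (eT : T -> nat)
    opS opT mS mT M : coding dS eS -> coding dT eT ->
  coded opS dS eS mS -> coded opT dT eT mT -> iso_table mS mT M ->
  op_isom opS opT.
Proof.
move=> codS codT cS cT /and4P[/eqP sM uM aM homM].
exists (decode_map eS dT M); first exact: (decode_map_bij codS codT).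
exact: (decode_map_morph codS codT cS cT).
Qed.

(** Any member of [isos t m] is a certificate. It maps [grp t] to [m], so the isomorphism is
    inverted to start from [mul]. *)
Lemma has_group_type_coded (S : Type) (mul : S -> S -> S) d e m t :
  coding d e -> coded mul d e m -> isos t m != [::] -> has_group_type mul t.
Proof.
move=> cod cM; case E: isos => [//|M s] _.
have: M \in isos t m by rewrite E mem_head.
rewrite mem_filter => /andP[isoM _] {E s}.
have isoA k : additive_type k = t ->
    op_isom mul (fun a b : additive_group k => (a + b)%R).
  move=> kt; apply/op_isom_sym; rewrite -{}kt in isoM.
  exact: op_isom_coded (coding_dec k) cod (@coded_add k) cM isoM.
have isoT : op_isom mul (fun a b : table_group t => a * b)%g.
  apply/op_isom_sym.
  exact: op_isom_coded (coding_table_group t) cod (@coded_table_group t) cM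
    isoM.
case: t isoM isoA isoT => isoM isoA isoT.
- exact: (isoA AZ8).
- exact: (isoA AZ2xZ4).
- exact: (isoA AZ2xZ2xZ2).
- exists (table_group GD4) => //; exact: D4_presentation.
- exists (table_group GQ) => //; exact: Q_presentation.
Qed.

(** * Braces of order eight *)

Lemma all_codes2P (P : nat -> nat -> bool) :
  reflect (forall i j, i < 8 -> j < 8 -> P i j)
          (all (fun i => all (P i) codes) codes).
Proof.
apply: (iffP (all_codesP _)) => [PT i j lt_i | PT i lt_i].
  by move: j; apply/all_codesP/PT.
by apply/all_codesP=> j; apply: PT.
Qed.

Lemma all_codes3P (P : nat -> nat -> nat -> bool) :
  reflect (forall i j k, i < 8 -> j < 8 -> k < 8 -> P i j k)
          (all (fun i => all (fun j => all (P i j) codes) codes) codes).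
Proof.
apply: (iffP (all_codes2P (fun i j => all (P i j) codes))).
  move=> PT i j k lti ltj; move: k; exact/all_codesP/PT.
move=> PT i j lti ltj.
by apply/all_codesP=> k; apply: PT.
Qed.

Definition entry0 : brace_entry := Z8_entry 8 GZ8 +%R.

Definition entry_table (i : nat) : seq (seq nat) := nth [::] op_tables i.

Lemma op_table_brace8 i : op_table (brace8 i) = entry_table i.
Proof.
rewrite /entry_table -map_op_table (nth_map entry0) //.
by rewrite /brace8 (tnth_nth entry0).
Qed.

Definition entry_dec (E : brace_entry) : nat -> entry_add E := dec _.
Definition entry_enc (E : brace_entry) : entry_add E -> nat := @enc _.

Lemma coded_entry_add E : coded (fun x y : entry_add E => x + y)%R
  (entry_dec E) (@entry_enc E) (grp (additive_type (entry_tag E))).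
Proof. exact: coded_add. Qed.

Lemma coding_entry E : coding (entry_dec E) (@entry_enc E).
Proof. exact: coding_dec. Qed.

Lemma coded_entry_mul i : coded (entry_mul (brace8 i))
  (entry_dec (brace8 i)) (@entry_enc (brace8 i)) (look (entry_table i)).
Proof. by move=> j k lt_j lt_k; rewrite -op_table_brace8 look_table. Qed.

(** In a left brace both identities coincide, so the unit of [m] is tested at 0. *)
Definition brace_check (add m : nat -> nat -> nat) : bool :=
  [&& all (fun i => all (fun j => all (fun k =>
        m i (m j k) == m (m i j) k) codes) codes) codes,
      all (fun i => (m 0 i == i) && (m i 0 == i)) codes,
      all (fun i => has (fun j => (m j i == 0) && (m i j == 0)) codes) codes &
      all (fun i => all (fun j => all (fun k =>
        add (m i (add j k)) i == add (m i j) (m i k)) codes) codes) codes].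

(** The condition [lambda_a = id], written without subtraction. *)
Definition socle_check (add m : nat -> nat -> nat) : nat :=
  count (fun i => all (fun j => m i j == add j i) codes) codes.

Lemma left_brace_coded (B : zmodType) (mul : B -> B -> B) d e add m :
  coding d e -> coded (fun x y => x + y)%R d e add -> coded mul d e m ->
  brace_check add m -> left_brace mul.
Proof.
move=> cod cA cM /and4P[/all_codes3P mA /all_codesP m1 /all_codesP mV].
move=> /all_codes3P mD; have [lt_e eK dK] := cod.
have eA := codedE cod cA; have eM := codedE cod cM; have inje := can_inj eK.
split; first split.
- by move=> x y z; apply: inje; rewrite !eM; apply/eqP/mA.
- exists (d 0); split=> [x|x|x].
  + by apply: inje; rewrite eM dK //; have /andP[/eqP] := m1 _ (lt_e x).
  + by apply: inje; rewrite eM dK //; have /andP[_ /eqP] := m1 _ (lt_e x).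
  + have /hasP[j] := mV _ (lt_e x).
    rewrite mem_codes => lt_j /andP[/eqP jx /eqP xj].
    by exists (d j); split; apply: inje; rewrite eM !dK.
by move=> x y z; apply: inje; rewrite !(eA, eM); apply/eqP/mD.
Qed.

Lemma card_coded (T : finType) d (e : T -> nat) (A : {set T}) :
  coding d e -> #|A| = count (fun i => d i \in A) codes.
Proof.
case=> lt_e eK dK; rewrite cardE -count_map -size_filter; apply: perm_size.
apply: uniq_perm; rewrite ?enum_uniq ?filter_uniq //.
  rewrite map_inj_in_uniq ?iota_uniq // => i j; rewrite !mem_codes => lti ltj.
  by move/(congr1 e); rewrite !dK.
move=> x; rewrite mem_enum mem_filter andb_idr // => _.
by apply/mapP; exists (e x); rewrite ?mem_codes ?eK.
Qed.

Lemma card_socle_coded (B : finZmodType) (mul : B -> B -> B) d e add m :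
  coding d e -> coded (fun x y => x + y)%R d e add -> coded mul d e m ->
  #|socle mul| = socle_check add m.
Proof.
move=> cod cA cM; have [lt_e eK dK] := cod; have inje := can_inj eK.
rewrite (card_coded _ cod); apply: eq_in_count => i; rewrite mem_codes => lt_i.
rewrite inE; apply/forallP/all_codesP => /= soc_i x.
  move=> lt_x; move/eqP: (soc_i (d x)) => /(canRL (subrK _)).
  by move/(congr1 e); rewrite cA ?cM // => ->.
rewrite subr_eq; apply/eqP/inje; rewrite (codedE cod cM) (codedE cod cA) dK //.
exact/eqP/soc_i.
Qed.

Definition entry_check (i : nat) : bool :=
  let E := nth entry0 braces8 i in let m := look (entry_table i) in
  let add := grp (additive_type (entry_tag E)) in
  [&& brace_check add m, socle_check add m == entry_soc E
    & isos (entry_type E) m != [::]].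

Lemma entries_check : all entry_check (iota 0 27).
Proof. by vm_compute. Qed.

Lemma brace8_nth i : brace8 i = nth entry0 braces8 i.
Proof. by rewrite /brace8 (tnth_nth entry0). Qed.

Lemma brace8_correct (i : 'I_(size braces8)) :
  [/\ left_brace (entry_mul (brace8 i)),
      #|socle (entry_mul (brace8 i))| = entry_soc (brace8 i) &
      has_group_type (entry_mul (brace8 i)) (entry_type (brace8 i))].
Proof.
have: entry_check i by apply: (allP entries_check); rewrite mem_iota ltn_ord.
rewrite /entry_check -brace8_nth => /and3P[brP /eqP socP isoP].
have cod := coding_entry (brace8 i); have cA := @coded_entry_add (brace8 i).
have cM := @coded_entry_mul i; split.
- exact: left_brace_coded cod cA cM brP.
- by rewrite (card_socle_coded cod cA cM).
- exact: has_group_type_coded cod cM isoP.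
Qed.

(** * Distinct entries are not isomorphic *)

Definition same_tag (k l : additive8) : bool :=
  match k, l with
  | AZ8, AZ8 | AZ2xZ4, AZ2xZ4 | AZ2xZ2xZ2, AZ2xZ2xZ2 => true
  | _, _ => false
  end.

Lemma same_tagP k l : reflect (k = l) (same_tag k l).
Proof. by case: k l => [] [] /=; constructor. Qed.

Definition indices (k : additive8) : seq nat :=
  [seq i <- iota 0 27 | same_tag (entry_tag (nth entry0 braces8 i)) k].

Lemma mem_indices k (i : 'I_(size braces8)) :
  (i : nat) \in indices k = same_tag (entry_tag (brace8 i)) k.
Proof.
have lt_i : i < 27 := ltn_ord i.
by rewrite mem_filter mem_iota lt_i !andbT brace8_nth.
Qed.

(** A brace isomorphism is in particular additive, so testing the members of [A] is exhaustive. For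
    [k] different from [l], [A] is empty. *)
Definition distinct_entries (k l : additive8) : bool :=
  let A := isos (additive_type k) (grp (additive_type l)) in
  all (fun i => all (fun j => (i == j) ||
        ~~ has (hom_table (look (entry_table i)) (look (entry_table j))) A)
    (indices l)) (indices k).

Lemma distinct_entriesT k l : distinct_entries k l.
Proof. by case: k l => [] []; vm_compute. Qed.

Lemma brace_isom_sym (B C : zmodType) (mB : B -> B -> B) (mC : C -> C -> C) :
  brace_isom mB mC -> brace_isom mC mB.
Proof.
case=> f [[g fK gK] fD fM]; exists g; split; first by exists f.
  by move=> x y; apply: (can_inj fK); rewrite fD !gK.
by move=> x y; apply: (can_inj fK); rewrite fM !gK.
Qed.

Lemma brace_isom_trans (B C D : zmodType) (mB : B -> B -> B)
    (mC : C -> C -> C) (mD : D -> D -> D) :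
  brace_isom mB mC -> brace_isom mC mD -> brace_isom mB mD.
Proof.
case=> f [bf fD fM] [g [bg gD gM]]; exists (g \o f); split=> [|x y|x y] /=.
- exact: bij_comp.
- by rewrite fD gD.
- by rewrite fM gM.
Qed.

Lemma enc0 k : enc (0%R : additive_group k) = 0.
Proof. by case: k. Qed.

Lemma dec0 k : dec k 0 = 0%R.
Proof. by case: k. Qed.

(** The table of an isomorphism lies in the list tested by [distinct_entries] and preserves
    products, which is excluded unless the indices agree. *)
Lemma brace8_isom_inj i j :
  brace_isom (entry_mul (brace8 i)) (entry_mul (brace8 j)) -> i = j.
Proof.
case=> f [bf fD fM].
set ki := entry_tag (brace8 i); set kj := entry_tag (brace8 j).
have [ci cj] := (coding_entry (brace8 i), coding_entry (brace8 j)).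
pose F := encode_map (entry_dec (brace8 i)) (@entry_enc (brace8 j)) f.
have FA := encode_map_hom ci cj (@coded_entry_add _) (@coded_entry_add _) fD.
have FM := encode_map_hom ci cj (@coded_entry_mul _) (@coded_entry_mul _) fM.
have ltF l : F l < 8 by exact: encode_map_lt cj _ _.
have f0 : f 0%R = 0%R by apply: (addIr (f 0%R)); rewrite -fD !add0r.
have isoF : [seq F l | l <- codes]
    \in isos (additive_type ki) (grp (additive_type kj)).
  apply: mem_isos => //.
  - exact: (encode_map_inj ci cj (bij_inj bf)).
  - by rewrite /F /encode_map [entry_dec _ 0]dec0 f0 [LHS]enc0.
have := distinct_entriesT ki kj; rewrite /distinct_entries => /allP/(_ i).
rewrite mem_indices => /(_ (introT (same_tagP _ _) erefl)) /allP/(_ j).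
rewrite mem_indices => /(_ (introT (same_tagP _ _) erefl)).
case/orP=> [/eqP/val_inj // | /hasP[]]; exists [seq F l | l <- codes] => //.
apply/hom_tableP=> a b lt_a lt_b.
have lt_ab : look (entry_table i) a b < 8.
  rewrite -(@coded_entry_mul i a b lt_a lt_b).
  by have [lt_e _ _] := ci; apply: lt_e.
rewrite (nth_codes _ _ lt_ab) (nth_codes _ _ lt_a) (nth_codes _ _ lt_b).
exact: FM.
Qed.

(** * Every brace of order eight is listed *)

Definition matches_entry (k : additive8) (A : seq (seq nat))
    (P : seq (seq nat)) : bool :=
  let m := look (table (fun i j =>
    grp (additive_type k) i (nth 0 (nth [::] P i) j))) in
  has_if (fun l => has_if (hom_table m (look (entry_table l))) A) (indices k).

(** [A] consists of the automorphisms of the additive group. It serves twice: as the possible values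
    of lambda and as the changes of coordinates allowed at a leaf. *)
Definition classification (k : additive8) : bool :=
  let A := isos (additive_type k) (grp (additive_type k)) in
  search (grp (additive_type k)) A (matches_entry k A) 9 start.

Lemma classificationT k : classification k.
Proof. by case: k; vm_compute. Qed.

Lemma classificationE k : classification k =
  search (grp (additive_type k))
    (isos (additive_type k) (grp (additive_type k)))
    (matches_entry k (isos (additive_type k) (grp (additive_type k)))) 9 start.
Proof. by []. Qed.

Lemma matches_entryP k A P :
  matches_entry k A P ->
  exists2 i : 'I_(size braces8), entry_tag (brace8 i) = k &
  exists2 M, M \in A & hom_table
    (look (table (fun i j =>
       grp (additive_type k) i (nth 0 (nth [::] P i) j))))
    (look (entry_table i)) M.
Proof.
rewrite /matches_entry has_ifE => /hasP[l]; rewrite has_ifE.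
move=> l_k /hasP[M M_A homM].
have lt_l : l < size braces8.
  by move: l_k; rewrite mem_filter mem_iota => /and3P[].
exists (Ordinal lt_l); last by exists M.
by apply/same_tagP; rewrite -mem_indices.
Qed.

Section Lambda.
Variables (B : zmodType) (mul : B -> B -> B).
Hypothesis braceB : left_brace mul.

Lemma brace_mulDr a b c : mul a (b + c)%R = (mul a b + mul a c - a)%R.
Proof. by rewrite -braceB.2 addrK. Qed.

(** The brace law at [b = c = 0], after cancellation. *)
Lemma brace_mulr0 a : mul a 0%R = a.
Proof. by apply: (addrI (mul a 0%R)); rewrite -[LHS]braceB.2 addr0. Qed.

Lemma brace_mulrI a : injective (mul a).
Proof.
have [[mulA [e [mul1 _ mulV]]] _] := braceB.
have [a' [a'a _]] := mulV a.
by move=> x y /(congr1 (mul a')); rewrite !mulA a'a !mul1.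
Qed.

Lemma lambdaD a : {morph brace_lambda mul a : b c / (b + c)%R}.
Proof.
by move=> b c; rewrite /brace_lambda brace_mulDr addrAC addrACA -addrA addrA.
Qed.

Lemma lambda0 a : brace_lambda mul a 0%R = 0%R.
Proof. by rewrite /brace_lambda brace_mulr0 subrr. Qed.

Lemma lambda_inj a : injective (brace_lambda mul a).
Proof. by move=> b c /addIr/brace_mulrI. Qed.

Lemma lambda_id : brace_lambda mul 0%R =1 id.
Proof.
have [[_ [e [mul1 _ _]]] _] := braceB.
have e0 : e = 0%R by rewrite -(mul1 0%R) brace_mulr0.
by move=> b; rewrite /brace_lambda -e0 mul1 e0 subr0.
Qed.

(** The brace law for [a] and the sum [(mul b c - b) + b], combined with associativity. *)
Lemma lambdaM a b c :
  brace_lambda mul (mul a b) c = brace_lambda mul a (brace_lambda mul b c).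
Proof.
have [[mulA _] _] := braceB; rewrite /brace_lambda -mulA.
have := braceB.2 a (mul b c - b)%R b; rewrite subrK.
by move/(canRL (addrK _)) => ->; rewrite addrAC addrK.
Qed.
End Lambda.

(** An additive isomorphism with one of the three groups carries the brace to codes. Its lambda
    tables meet the hypotheses of [search_sound], and the leaf test supplies an additive
    automorphism onto a listed formula. *)
Lemma brace8_complete (B : finZmodType) (mul : B -> B -> B) :
  left_brace mul -> #|B| = 8 ->
  exists i : 'I_(size braces8), brace_isom mul (entry_mul (brace8 i)).
Proof.
move=> brB /abelian_order8[k [f [[g fK gK] fD]]].
have [lt_enc encK decK] := coding_dec k.
pose d i := f (dec k i); pose e x := enc (g x); pose t := additive_type k.
have cod : coding d e.
  by split=> [x|x|i lt_i]; rewrite /d /e ?lt_enc ?encK ?gK ?fK ?decK.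
have [lt_e eK dK] := cod.
have cA : coded (fun x y => x + y)%R d e (grp t).
  by move=> i j lt_i lt_j; rewrite /d /e -fD fK coded_add.
have d0 : d 0 = 0%R.
  by rewrite /d dec0; apply: (addIr (f 0%R)); rewrite -fD !add0r.
pose F i j := e (brace_lambda mul (d i) (d j)).
pose lam i := [seq F i j | j <- codes].
have ltF i j : F i j < 8 by exact: lt_e.
have dF i j : i < 8 -> d (grp t i (F i j)) = mul (d i) (d j).
  move=> lt_i; apply: (can_inj eK).
  rewrite -[i in grp t i _]dK // -(codedE cod cA) eK.
  by rewrite /brace_lambda addrC subrK.
have lam_auts i : i < 8 -> lam i \in isos t (grp t).
  move=> lt_i; apply: mem_isos => [//| | |].
  - exact: (encode_map_inj cod cod (lambda_inj brB (a := d i))).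
  - by rewrite /F d0 lambda0 // -d0 dK.
  - exact: (encode_map_hom cod cod cA cA (lambdaD brB (d i))).
have lam_add i j : i < 8 -> j < 8 -> grp t i (nth 0 (lam i) j) < 8.
  by move=> lt_i lt_j; rewrite nth_codes ?grp_lt.
have lamM i j : i < 8 -> j < 8 ->
    lam (grp t i (nth 0 (lam i) j)) = [seq nth 0 (lam i) l | l <- lam j].
  move=> lt_i lt_j; rewrite nth_codes // -map_comp; apply: eq_map => l /=.
  by rewrite nth_codes // /F dF // lambdaM // eK.
(* Place 0 holds the identity, which is [lambda_0]; the other seven places are unknown. *)
have agS : agrees lam start.
  split=> // -[_|i lt_i]; last 
    by left; rewrite -[LHS]/(nth [::] (nseq 7 [::]) i) nth_nseq if_same.
  right; rewrite -[LHS]map_id; apply/eq_in_map => j; rewrite mem_codes => lt_j.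
  by rewrite /F d0 lambda_id // dK.
have := classificationT k; rewrite classificationE => cl.
have /matches_entryP[i tag_i [M M_iso homM]] :=
  search_sound lam_auts lam_add lamM agS cl.
exists i.
have codE := coding_entry (brace8 i).
have cAE := @coded_entry_add (brace8 i); rewrite tag_i in cAE.
move: M_iso; rewrite mem_filter => /andP[/and4P[/eqP sM uM aM homA] _].
exists (decode_map e (entry_dec (brace8 i)) M); split.
- exact: (decode_map_bij cod codE).
- exact: (decode_map_morph cod codE cA cAE).
(* [homM] concerns the product rebuilt from the lambda tables; [dF] identifies it with [mul]. *)
- apply: (decode_map_morph cod codE _ (@coded_entry_mul i) aM sM homM).
  move=> a b lt_a lt_b; rewrite look_table // nth_codes // nth_codes //.
  by rewrite -dF // dK ?grp_lt.
Qed.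

Theorem theorem3p1 :
  (forall i : 'I_(size braces8),
     [/\ left_brace (entry_mul (brace8 i)),
         #|socle (entry_mul (brace8 i))| = entry_soc (brace8 i) &
         has_group_type (entry_mul (brace8 i)) (entry_type (brace8 i))]) /\
  (forall (B : finZmodType) (mul : B -> B -> B),
     left_brace mul -> #|B| = 8 ->
     exists! i : 'I_(size braces8),
       brace_isom mul (entry_mul (brace8 i))).
Proof.
split=> [|B mul brB oB]; first exact: brace8_correct.
have [i iso_i] := brace8_complete brB oB; exists i; split=> // j iso_j.
exact: brace8_isom_inj (brace_isom_trans (brace_isom_sym iso_i) iso_j).
Qed.
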